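(* Let $(S,\to)$ and $(S',\to')$ be transition systems, let $\sim\ \subseteq S\times S'$, let $\trianglelefteq$ be a binary relation on $S$ and $\trianglelefteq'$ a binary relation on $S'$, let $\phi$ be a predicate on $S$ and $\phi'$ a predicate on $S'$, and let $I\subseteq S$. Assume: (0) $\to$ simulates $\to'$ via the converse of $\sim$: for all $s\in S$, $s',t'\in S'$, if $s\sim s'$ and $s'\to' t'$ then there is $t\in S$ with $s\to t$ and $t\sim t'$; (1) $\trianglelefteq'$ simulates $\trianglelefteq$ with $\sim$: for all $s,t\in S$, $s'\in S'$, if $s\sim s'$ and $s\trianglelefteq t$ then there is $t'\in S'$ with $s'\trianglelefteq' t'$ and $t\sim t'$; (2) for all $s,t\in S$ and $s',t'\in S'$, if $s\sim s'$, $t\sim t'$ and $s'\trianglelefteq' t'$, then $s\trianglelefteq t$; (3) for all $s\in S$, $s'\in S'$, if $s\sim s'$ and $\phi'(s')$ then $\phi(s)$. Let $I':=\{s'\in S'\mid\exists s\in I.\ s\sim s'\}$. Then: (a) If for all $s\in I$ and $t\in S$ with $s\to t$ there exists $r\in I$ with $t\trianglelefteq r$, then for all $s'\in I'$ and $t'\in S'$ with $s'\to' t'$ there exists $r'\in I'$ with $t'\trianglelefteq' r'$. (b) Let $f:I\to\mathbb{Z}$ satisfy: for all $s,r\in I$ and $t\in S$ with $s\to t$ and $t\trianglelefteq r$, $f(s)\ge f(r)$, and if moreover $\phi(s)$ then $f(s)>f(r)$. Assume that for each $s'\in I'$ the minimum $f'(s'):=\min\{f(s)\mid s\in I\wedge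 s\sim s'\}$ exists (e.g. if $I$ is finite). Then for all $s',r'\in I'$ and $t'\in S'$ with $s'\to' t'$ and $t'\trianglelefteq' r'$, $f'(s')\ge f'(r')$, and if moreover $\phi'(s')$ then $f'(s')>f'(r')$.
   Context: A transition system $(S,\to)$ is a set $S$ with a relation $\to\subseteq S\times S$. *)

(* Defs.v *)
From Stdlib Require Import ZArith List Relations ClassicalEpsilon FinFun.

Record transition_system := TransitionSystem {
  state :> Type;
  step : relation state
}.
Arguments step {_} _ _.

(* [simulates R' R sim]: the relation [R'] simulates [R] via [sim].  The simulating relation
   comes first. *)
Definition simulates {A B : Type} (R' : relation B) (R : relation A)
    (sim : A -> B -> Prop) : Prop :=
  forall (s t : A) (s' : B), sim s s' -> R s t -> exists t' : B, R' s' t' /\ sim t t'.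

Definition converse {A B : Type} (sim : A -> B -> Prop) : B -> A -> Prop :=
  fun b a => sim a b.

Definition rel_image {A B : Type} (sim : A -> B -> Prop) (I : A -> Prop) : B -> Prop :=
  fun b => exists a : A, I a /\ sim a b.

Definition is_minimum (E : Z -> Prop) (m : Z) : Prop :=
  E m /\ (forall n : Z, E n -> (m <= n)%Z).

(* Meaningful only if [E] has a minimum; otherwise an unspecified integer. *)
Definition minimum (E : Z -> Prop) : Z := epsilon (inhabits 0%Z) (is_minimum E).

Definition related_values {A B : Type} (sim : A -> B -> Prop) {I : A -> Prop}
    (f : {a : A | I a} -> Z) (b : B) : Z -> Prop :=
  fun z => exists a : {a : A | I a}, sim (proj1_sig a) b /\ f a = z.

(* Well defined as a minimum only where [related_values sim f b] has one. *)
Definition min_transfer {A B : Type} (sim : A -> B -> Prop) {I : A -> Prop}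
    (f : {a : A | I a} -> Z) : {b : B | rel_image sim I b} -> Z :=
  fun b => minimum (related_values sim f (proj1_sig b)).

(* Main.v *)
Require Import Defs.
From Stdlib Require Import ZArith List Relations ClassicalEpsilon FinFun Lia.

(** Steps in $S'$ are pulled back to $S$ by [h0], and the assumption on $S$ is applied there. For
    (a), [h1] then pushes $t \trianglelefteq r$ forward to $S'$. For (b), $f'(s')$ and $f'(r')$ are
    values of $f$ at some $s \sim s'$ and $r \sim r'$ ([minimum_spec]); [h2] reflects $t'
    \trianglelefteq' r'$ to $t \trianglelefteq r$, so the inequality between $f(s)$ and $f(r)$ is
    the desired one. For finite $I$ the minima exist by [related_values_minimum]. *)

Lemma list_argmin {X : Type} (P : X -> Prop) (f : X -> Z) (l : list X) :
  (exists x, In x l /\ P x) ->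
  exists x, P x /\ forall y, In y l -> P y -> (f x <= f y)%Z.
Proof.
induction l as [|a l IH]; intros [x [Hx Px]]; [destruct Hx|].
(* [P] need not be decidable, hence the classical case split. *)
destruct (classic (exists y, In y l /\ P y)) as [Hl|Hl].
- destruct (IH Hl) as [z [Pz Hz]].
  destruct (classic (P a /\ (f a <= f z)%Z)) as [[Pa Ha]|Ha].
  + exists a; split; [exact Pa|].
    intros y [<-|Hy] Py; [lia|].
    specialize (Hz y Hy Py); lia.
  + exists z; split; [exact Pz|].
    intros y [<-|Hy] Py; [|exact (Hz y Hy Py)].
    destruct (Z.le_gt_cases (f z) (f a)) as [H|H]; [exact H|].
    exfalso; apply Ha; split; [exact Py|lia].
(* No element of the tail satisfies [P], so [x] and every competitor equal the head [a]. *)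
- exists x; split; [exact Px|].
  intros y Hy Py.
  destruct Hx as [<-|Hx]; [|exfalso; apply Hl; exists x; auto].
  destruct Hy as [<-|Hy]; [lia|exfalso; apply Hl; exists y; auto].
Qed.

Lemma minimum_spec (E : Z -> Prop) :
  (exists m, is_minimum E m) -> is_minimum E (minimum E).
Proof. exact (epsilon_spec (inhabits 0%Z) (is_minimum E)). Qed.

(** A list enumerating $I$ has an element of least $f$ among those related to [b]; membership of [b]
    in the image of $I$ ensures that there is one. *)
Lemma related_values_minimum {A B : Type} (sim : A -> B -> Prop) {I : A -> Prop}
    (f : {a : A | I a} -> Z) (b : B) :
  Finite {a : A | I a} -> rel_image sim I b ->
  exists m, is_minimum (related_values sim f b) m.
Proof.
intros [l Hl] [a [Ia Hab]].
destruct (list_argmin (fun x => sim (proj1_sig x) b) f l) as [x [Hx Hmin]].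
- exists (exist _ a Ia); split; [apply Hl|exact Hab].
- exists (f x); split; [exists x; auto|].
  intros n [y [Hy <-]]; exact (Hmin y (Hl y) Hy).
Qed.

Theorem theorem5 (S S' : transition_system) (sim : S -> S' -> Prop)
    (le : relation S) (le' : relation S')
    (phi : S -> Prop) (phi' : S' -> Prop) (I : S -> Prop)
    (h0 : simulates (@step S) (@step S') (converse sim))
    (h1 : simulates le' le sim)
    (h2 : forall (s t : S) (s' t' : S'), sim s s' -> sim t t' -> le' s' t' -> le s t)
    (h3 : forall (s : S) (s' : S'), sim s s' -> phi' s' -> phi s) :
  let I' : S' -> Prop := rel_image sim I in
  ((forall s t : S, I s -> step s t -> exists r : S, I r /\ le t r) ->
    forall s' t' : S', I' s' -> step s' t' -> exists r' : S', I' r' /\ le' t' r')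
  /\
  (forall f : {s : S | I s} -> Z,
    (forall (s r : {s : S | I s}) (t : S),
      step (proj1_sig s) t -> le t (proj1_sig r) ->
      (f s >= f r)%Z /\ (phi (proj1_sig s) -> (f s > f r)%Z)) ->
    (Finite {s : S | I s} ->
      forall s' : S', I' s' -> exists m : Z, is_minimum (related_values sim f s') m)
    /\
    ((forall s' : S', I' s' -> exists m : Z, is_minimum (related_values sim f s') m) ->
      let f' : {s' : S' | I' s'} -> Z := min_transfer sim f in
      forall (s' r' : {s' : S' | I' s'}) (t' : S'),
        step (proj1_sig s') t' -> le' t' (proj1_sig r') ->
        (f' s' >= f' r')%Z /\ (phi' (proj1_sig s') -> (f' s' > f' r')%Z))).
Proof.
intros I'; subst I'; split.
- intros H s' t' [s [Is Hs]] Hst'.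
  (* Through [converse], [h0] takes the primed states first. *)
  destruct (h0 s' t' s Hs Hst') as [t [Hst Ht]].
  destruct (H s t Is Hst) as [r [Ir Htr]].
  destruct (h1 t r t' Ht Htr) as [r' [Htr' Hr]].
  exists r'; split; [exists r; auto|exact Htr'].
- intros f Hf; split.
  + intros Hfin s' Is'; exact (related_values_minimum sim f s' Hfin Is').
  + intros Hmin f' s' r' t' Hst' Htr'.
    (* Both minima are attained, at related states [s] and [r] to which [Hf] applies. *)
    destruct (minimum_spec _ (Hmin _ (proj2_sig s'))) as [[s [Hs Es]] _].
    destruct (minimum_spec _ (Hmin _ (proj2_sig r'))) as [[r [Hr Er]] _].
    destruct (h0 _ t' _ Hs Hst') as [t [Hst Ht]].
    (* Here [r] is already fixed as a minimizer; [h2] yields [le t r] for this very [r]. *)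
    destruct (Hf s r t Hst (h2 t _ t' _ Ht Hr Htr')) as [Hge Hgt].
    unfold f', min_transfer; rewrite <- Es, <- Er.
    split; [exact Hge|].
    intros Hphi; exact (Hgt (h3 _ _ Hs Hphi)).
Qed.
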